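(* Let $X=GI(n;j_0,\dots,j_{t-1})$ be a connected $GI$-graph with $t$ layers, where $t\ge 2$. If $X$ has a skew automorphism, then either $t=2$ and $X$ is isomorphic to one of the seven generalized Petersen graphs $G(4,1)$, $G(5,2)$, $G(8,3)$, $G(10,2)$, $G(10,3)$, $G(12,5)$ and $G(24,5)$, or $t=3$ and $X$ is isomorphic to $GI(3;1,1,1)$. Moreover, each of these eight graphs is arc-transitive (and is therefore both vertex-transitive and edge-transitive).
   Context: For integers $n\ge 3$, $t\ge 1$ and a sequence $j_0,\dots,j_{t-1}$ of integers with $0<j_k<n$ and $j_k\neq n/2$, the $GI$-graph $GI(n;j_0,\dots,j_{t-1})$ is the graph with vertex set $\mathbb{Z}_t\times\mathbb{Z}_n$ and two types of edges: spoke edges, joining $(s,v)$ to $(s',v)$ for all distinct $s,s'\in\mathbb{Z}_t$ and all $v\in\mathbb{Z}_n$; and layer edges, joining $(s,v)$ to $(s,v+j_s)$ and $(s,v-j_s)$ for all $s\in\mathbb{Z}_t$, $v\in\mathbb{Z}_n$. The sets $L_s=\{(s,v):v\in\mathbb{Z}_n\}$ are the layers. The generalized Petersen graph $G(n,k)$ is the graph $GI(n;1,k)$. The fundamental edge-partition is the partition of the edges into spoke edges and layer edges; an automorphism respects it if it takes spoke edges to spoke edges and layer edges to layer edges. An automorphism that does not respect the fundamental edge-partition is called skew. *)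

(* Defs.v *)
From HB Require Import structures.
From mathcomp Require Import all_boot all_order all_algebra all_fingroup.

Set Implicit Arguments.
Unset Strict Implicit.
Unset Printing Implicit Defensive.

Import GRing.Theory.

(* A finite simple graph is given by its adjacency relation on a finType,
   which is symmetric and irreflexive (see GI_sym and GI_irrefl). *)

Section Graphs.

Variables (T : finType) (e : rel T).

Definition graph_connected : Prop := forall x y : T, connect e x y.

Definition automorphism (f : {perm T}) : Prop := {mono f : x y / e x y}.

Definition vertex_transitive : Prop :=
  forall x x' : T, exists2 f : {perm T}, automorphism f & f x = x'.

(* Edges are the unordered pairs [set x; y] with e x y. *)
Definition edge_transitive : Prop :=
  forall x y x' y' : T, e x y -> e x' y' ->
    exists2 f : {perm T}, automorphism f & f @: [set x; y] = [set x'; y'].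

(* Arcs are the ordered pairs (x, y) with e x y. *)
Definition arc_transitive : Prop :=
  forall x y x' y' : T, e x y -> e x' y' ->
    exists2 f : {perm T}, automorphism f & f x = x' /\ f y = y'.

End Graphs.

Definition isomorphic (T1 T2 : finType) (e1 : rel T1) (e2 : rel T2) : Prop :=
  exists2 f : T1 -> T2, bijective f & {mono f : x y / e1 x y >-> e2 x y}.

Section GIGraphs.

(* 'Z_n is the ring of integers mod n only for n >= 2; all uses of these
   definitions have n >= 3. *)
Variables (n t : nat) (j : t.-tuple nat).

Definition GI_params : Prop :=
  [/\ 3 <= n, 1 <= t &
      forall k : 'I_t, 0 < tnth j k < n /\ (tnth j k).*2 <> n].

Definition GI_vertex : finType := ('I_t * 'Z_n)%type.

Definition spoke : rel GI_vertex :=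
  fun x y => (x.1 != y.1) && (x.2 == y.2).

Definition layer : rel GI_vertex :=
  fun x y => (x.1 == y.1) &&
    ((y.2 == x.2 + (tnth j x.1)%:R) || (y.2 == x.2 - (tnth j x.1)%:R))%R.

Definition GI : rel GI_vertex := fun x y => spoke x y || layer x y.

Definition respects_fundamental_partition (f : {perm GI_vertex}) : Prop :=
  (forall x y, spoke x y -> spoke (f x) (f y)) /\
  (forall x y, layer x y -> layer (f x) (f y)).

Definition skew_automorphism (f : {perm GI_vertex}) : Prop :=
  automorphism GI f /\ ~ respects_fundamental_partition f.

Lemma GI_sym : symmetric GI.
Proof.
move=> [s u] [s' v]; rewrite /GI /spoke /layer /= [s' == s]eq_sym [v == u]eq_sym.
case: (eqVneq s s') => //= <-.
have E x y a : (x == y - a :> 'Z_n)%R = (y == x + a)%R by rewrite eq_sym subr_eq.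
by rewrite !E orbC.
Qed.

Lemma GI_irrefl : GI_params -> irreflexive GI.
Proof.
move=> [n3 _ Hj] [s u]; rewrite /GI /spoke /layer /= !eqxx /=.
have /andP[j0 jn] := (Hj s).1.
have n1 : 1 < n by apply: leq_trans n3.
have jN0 : ((tnth j s)%:R != 0 :> 'Z_n)%R.
  apply/eqP => /(congr1 val); rewrite /= val_Zp_nat // modn_small // => E.
  by rewrite E in j0.
have addN0 (a : 'Z_n) : (a != 0 -> (u == u + a) = false)%R.
  by move=> a0; rewrite eq_sym -subr_eq0 addrAC subrr add0r (negbTE a0).
by rewrite !addN0 ?oppr_eq0.
Qed.

End GIGraphs.

Arguments GI n {t} j _ _.

(* The generalized Petersen graph G(n, k). *)
Definition GP (n k : nat) : rel (GI_vertex n 2) := GI n [tuple 1; k].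

Arguments GP n k _ _ : clear implicits.

Definition exceptional_GP : seq (nat * nat) :=
  [:: (4, 1); (5, 2); (8, 3); (10, 2); (10, 3); (12, 5); (24, 5)].

(* Main.v *)
Require Import Defs.
From mathcomp Require Import all_boot all_order all_algebra all_fingroup.
From mathcomp Require Import ring.

(** An automorphism that mixes spokes with layer edges makes these two kinds of
    edges indistinguishable, and for almost all parameters they can be told
    apart by counting short cycles.

    With at least three layers, triangles suffice.  A spoke has t - 2 common
    neighbours, one in each remaining layer.  The endpoints of a layer edge in
    layer s have at most one common neighbour, and they have one only when
    3 j_s = 0.  A spoke sent to a layer edge therefore forces t = 3, and then
    the three vertices of its spoke triangle all land in a layer every edge of
    which lies on a triangle.  Pulling back, every layer edge lies on a
    triangle, so 3 annihilates all the j_s; connectedness gives n = 3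
    (skew_many_layers).

    With two layers, the translations and reflections of Z_n leave only four
    classes of arcs: the layer arcs of either layer and the spokes in either
    direction.  A single skew automorphism fuses them, so the graph is
    arc-transitive (I_graph_skew_arc_transitive).  Arc-transitivity makes the
    number of closed non-backtracking walks of length m starting with a given
    arc independent of the arc.  Such a walk is a word in formal steps; it
    moves along layer 0 by a steps and along layer 1 by b steps, and it closes
    up exactly when a j_0 + b j_1 = 0 in Z_n.  Hence the counts only depend on
    which pairs (a, b) lie in the lattice of relations between j_0 and j_1, and
    for m = 8 only finitely many small pairs matter.  Without any nontrivial
    relation a spoke starts 4 such walks and a layer arc only 2; the relations
    on one line through the origin cannot restore the balance
    (balanced_two_relations).  So there are two independent short relations p
    and q, and connectedness gives that n divides det p q, which is at most 64.
    A finite computation (balanced_pairs_exceptional) inspects the remaining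
    triples (n, j_0, j_1): those balanced for m = 8 and m = 10 are carried to one
    of the seven generalized Petersen graphs by a unit of Z_n, possibly with the
    layers exchanged.

    Conversely, each of the seven graphs has an explicit skew involution, and
    the fusion argument for two layers shows that it is arc-transitive.  The
    graph GI(3;1,1,1) is the 3 x 3 rook graph, on which permutations of the rows
    and of the columns and the exchange of the coordinates act. *)

Set Implicit Arguments.
Unset Strict Implicit.
Unset Printing Implicit Defensive.

Import GRing.Theory.

(** * Automorphisms and non-backtracking walks of a graph *)

Section Graphs.

Variables (T : finType) (e : rel T).

Lemma automorphismM (f g : {perm T}) :
  automorphism e f -> automorphism e g -> automorphism e (f * g)%g.
Proof. by move=> fE gE x y; rewrite !permM gE fE. Qed.

Lemma automorphismV (f : {perm T}) : automorphism e f -> automorphism e f^-1%g.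
Proof. by move=> fE x y; rewrite -fE !permKV. Qed.

Definition same_arc_orbit (a b : T * T) : Prop :=
  exists2 f : {perm T}, automorphism e f & f a.1 = b.1 /\ f a.2 = b.2.

Lemma same_arc_orbit_sym a b : same_arc_orbit a b -> same_arc_orbit b a.
Proof.
case=> f fE [f1 f2]; exists f^-1%g; first exact: automorphismV.
by rewrite -f1 -f2 !permK.
Qed.

Lemma same_arc_orbit_trans b a c :
  same_arc_orbit a b -> same_arc_orbit b c -> same_arc_orbit a c.
Proof.
case=> f fE [f1 f2] [g gE [g1 g2]].
by exists (f * g)%g; [exact: automorphismM | rewrite !permM f1 f2].
Qed.

Lemma same_arc_orbit_rev x y u v :
  same_arc_orbit (x, y) (u, v) -> same_arc_orbit (y, x) (v, u).
Proof. by case=> f fE [f1 f2]; exists f. Qed.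

Lemma same_arc_orbit_aut f x y :
  automorphism e f -> same_arc_orbit (x, y) (f x, f y).
Proof. by move=> fE; exists f. Qed.

Lemma arc_transitive_from a :
  (forall x y, e x y -> same_arc_orbit a (x, y)) -> arc_transitive e.
Proof.
move=> aE x y x' y' /aE/same_arc_orbit_sym xa /aE ax'.
exact: same_arc_orbit_trans xa ax'.
Qed.

Lemma arc_vertex_transitive :
  (forall x, exists y, e x y) -> arc_transitive e -> vertex_transitive e.
Proof.
move=> eN eT x x'; have [[y xy] [y' xy']] := (eN x, eN x').
by have [f fE [fx _]] := eT _ _ _ _ xy xy'; exists f.
Qed.

Lemma arc_edge_transitive : arc_transitive e -> edge_transitive e.
Proof.
move=> eT x y x' y' xy xy'; have [f fE [fx fy]] := eT _ _ _ _ xy xy'.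
by exists f => //; rewrite imsetU1 imset_set1 fx fy.
Qed.

(** The walks with m + 1 edges whose first arc is (x, y), whose last arc is
    (u, v), and which never turn back along the edge just used; for equal end
    arcs these are the entries of the m-th power of the Hashimoto matrix on its
    diagonal.  Closing up at an arc, not at a vertex, keeps closed walks with a
    tail out of the count. *)
Fixpoint nb_walks (m : nat) (x y u v : T) : nat :=
  if m is m'.+1 then \sum_(w | e y w && (w != x)) nb_walks m' y w u v
  else (x == u) && (y == v).

Lemma nb_walks_aut f m x y u v :
  automorphism e f -> nb_walks m (f x) (f y) (f u) (f v) = nb_walks m x y u v.
Proof.
move=> fE; elim: m => [|m IH] in x y *; rewrite /= ?(inj_eq perm_inj) //.
rewrite (reindex_inj (@perm_inj _ f)); apply: eq_big => w; last by rewrite IH.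
by rewrite fE (inj_eq perm_inj).
Qed.

Lemma nb_walks_arc_transitive m x y x' y' :
  arc_transitive e -> e x y -> e x' y' ->
  nb_walks m x y x y = nb_walks m x' y' x' y'.
Proof.
move=> eT xy /(eT _ _ _ _ xy)[f fE [<- <-]].
by rewrite nb_walks_aut.
Qed.

End Graphs.

(** * Dihedral symmetries of a GI-graph *)

Section GIGraph.

Local Open Scope ring_scope.

Variables (n t : nat) (j : t.-tuple nat).

Local Notation e := (GI n j).

Lemma layer_pair s v w :
  layer j (s, v) (s, w) =
  (w == v + (tnth j s)%:R :> 'Z_n) || (w == v - (tnth j s)%:R).
Proof. by rewrite /layer /= eqxx. Qed.

Lemma GI_same_layer s v w : e (s, v) (s, w) = layer j (s, v) (s, w).
Proof. by rewrite /GI /spoke /= eqxx. Qed.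

Lemma GI_other_layer s s' (v w : 'Z_n) : s != s' -> e (s, v) (s', w) = (v == w).
Proof. by move=> ss'; rewrite /GI /spoke /layer /= ss' (negbTE ss') orbF. Qed.

Lemma spoke_GI x y : @spoke n t x y -> e x y.
Proof. by rewrite /GI => ->. Qed.

Lemma layer_GI x y : layer j x y -> e x y.
Proof. by rewrite /GI => ->; rewrite orbT. Qed.

Lemma translation_inj (c : 'Z_n) :
  injective (fun x : GI_vertex n t => (x.1, x.2 + c) : GI_vertex n t).
Proof. by move=> [s v] [s' v'] /pair_equal_spec[/= -> /addIr->]. Qed.

Lemma reflection_inj (c : 'Z_n) :
  injective (fun x : GI_vertex n t => (x.1, c - x.2) : GI_vertex n t).
Proof. by move=> [s v] [s' v'] /pair_equal_spec[/= -> /addrI/oppr_inj->]. Qed.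

Definition translation c : {perm GI_vertex n t} := perm (@translation_inj c).
Definition reflection c : {perm GI_vertex n t} := perm (@reflection_inj c).

Lemma automorphism_translation c : automorphism e (translation c).
Proof.
move=> [s v] [s' v']; rewrite !permE /GI /spoke /layer /=.
by rewrite !(addrAC v c) !(inj_eq (@addIr _ c)).
Qed.

Lemma automorphism_reflection c : automorphism e (reflection c).
Proof.
move=> [s v] [s' v']; rewrite !permE /GI /spoke /layer /=.
have E a : (c - v' == c - v + a) = (v' == v - a).
  by rewrite -(inj_eq (@subrI _ c)) subKr opprD addrA subKr.
by rewrite (inj_eq (subrI c)) !E opprK [X in _ || _ && X]orbC.
Qed.

(** Two arcs of a layer step by the same amount or by opposite amounts; a
    translation matches them in the first case and a reflection in the second. *)
Lemma layer_same_arc_orbit s v v' w w' :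
  layer j (s, v) (s, v') -> layer j (s, w) (s, w') ->
  same_arc_orbit e ((s, v), (s, v')) ((s, w), (s, w')).
Proof.
rewrite !layer_pair => vv' ww'.
have [E|E] : w' - w = v' - v \/ w' - w = v - v'.
- by case/orP: vv' => /eqP->; case/orP: ww' => /eqP->;
    [left | right | right | left]; ring.
- exists (translation (w - v)); first exact: automorphism_translation.
  rewrite !permE /=; split; congr (_, _); first by ring.
  by apply: (@addIr _ (- w)); rewrite E; ring.
exists (reflection (w + v)); first exact: automorphism_reflection.
rewrite !permE /=; split; congr (_, _); first by ring.
by apply: (@addIr _ (- w)); rewrite E; ring.
Qed.

Lemma spoke_same_arc_orbit s s' v w :
  same_arc_orbit e ((s, v), (s', v)) ((s, w), (s', w)).
Proof.
exists (translation (w - v)); first exact: automorphism_translation.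
by rewrite !permE /=; split; congr (_, _); ring.
Qed.

(** A skew automorphism sends a spoke to a layer edge or a layer edge to a
    spoke; in the second case its inverse does the former. *)
Lemma skew_spoke_to_layer (f : {perm GI_vertex n t}) : skew_automorphism j f ->
  exists2 g : {perm GI_vertex n t}, automorphism e g &
    exists x y, spoke x y /\ layer j (g x) (g y).
Proof.
case=> fE fNr.
case: (boolP [exists x, exists y, spoke x y && layer j (f x) (f y)]).
  by case/existsP=> x /existsP[y /andP[xy fxy]]; exists f => //; exists x, y.
case: (boolP [exists x, exists y, layer j x y && spoke (f x) (f y)]).
  case/existsP=> x /existsP[y /andP[xy fxy]] _.
  exists f^-1%g; first exact: automorphismV.
  by exists (f x), (f y); rewrite !permK.
move/existsPn=> lN /existsPn sN; case: fNr; split=> x y xy.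
  have /existsPn/(_ y) := sN x; rewrite xy /= => fxyN.
  by have := spoke_GI xy; rewrite -fE /GI (negbTE fxyN) orbF.
have /existsPn/(_ y) := lN x; rewrite xy /= => fxyN.
by have := layer_GI xy; rewrite -fE /GI (negbTE fxyN).
Qed.

End GIGraph.

Lemma GI_arc_vertex_edge_transitive n t (j : t.-tuple nat) :
  arc_transitive (GI n j) ->
  [/\ arc_transitive (GI n j), vertex_transitive (GI n j) & edge_transitive (GI n j)].
Proof.
move=> jT; split=> //; last exact: arc_edge_transitive.
apply: arc_vertex_transitive jT => -[s v]; exists (s, v + (tnth j s)%:R)%R.
by rewrite GI_same_layer layer_pair eqxx.
Qed.

(** * Isomorphisms and annihilators *)

Lemma Zp_nat_eq0 n m : 1 < n -> (m%:R == 0 :> 'Z_n)%R = (n %| m).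
Proof. by move=> n1; rewrite -val_eqE /= val_Zp_nat. Qed.

Section Params.

Local Open Scope ring_scope.

Variables (n t : nat) (j : t.-tuple nat).
Hypothesis Hj : GI_params n j.

Local Notation e := (GI n j).

Lemma GI_params_n_gt1 : (1 < n)%N.
Proof. by case: Hj => n3 _ _; apply: leq_trans n3. Qed.

Lemma GI_params_j_neq0 s : (tnth j s)%:R != 0 :> 'Z_n.
Proof.
case: Hj => _ _ /(_ s)[/andP[j0 jn] _].
by rewrite Zp_nat_eq0 ?GI_params_n_gt1 // gtnNdvd.
Qed.

(** Along any edge the second coordinate changes by a multiple of some j_s, so
    D times it is constant on the component of (0, 0), which contains (0, 1). *)
Lemma connected_annihilator D : graph_connected e ->
  (forall s, (D * tnth j s)%:R = 0 :> 'Z_n) -> (n %| D)%N.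
Proof.
move=> econn Dj; rewrite -Zp_nat_eq0 ?GI_params_n_gt1 //.
have t0 : (0 < t)%N by case: Hj.
pose a := [pred x : GI_vertex n t | D%:R * x.2 == 0].
have /closed_connect/(_ _ _ (econn (Ordinal t0, 0) (Ordinal t0, 1))) : closed e a.
  move=> [s v] [s' v']; case/orP; rewrite /spoke /layer /= => /andP[_].
    by move/eqP<-.
  rewrite !inE /=; case/orP=> /eqP->;
  by rewrite ?mulrDr ?mulrN -natrM Dj ?subr0 ?addr0.
by rewrite !inE /= mulr0 mulr1 eqxx => <-.
Qed.

End Params.

Section Isomorphism.

Local Open Scope ring_scope.

(** Permuting the layers and multiplying Z_n by a unit; the layer edges only
    see each j_s up to sign. *)
Lemma GI_isomorphic n t (i j : t.-tuple nat) (p : {perm 'I_t}) (c : 'Z_n) :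
  c \is a GRing.unit ->
  (forall s, c * (tnth i s)%:R = (tnth j (p s))%:R \/
             c * (tnth i s)%:R = - (tnth j (p s))%:R) ->
  isomorphic (GI n i) (GI n j).
Proof.
move=> cU ij; exists (fun x => (p x.1, c * x.2)).
  exists (fun x => ((p^-1)%g x.1, c^-1 * x.2)) => -[s v] /=.
    by rewrite permK mulKr.
  by rewrite permKV mulVKr.
have cI : injective ( *%R c : 'Z_n -> 'Z_n) by apply: can_inj (mulKr cU).
move=> [s v] [s' v']; rewrite /GI /spoke /layer /= (inj_eq perm_inj) (inj_eq cI).
congr (_ || _ && _); case: (ij s) => E.
  by rewrite -E -mulrDr -mulrBr !(inj_eq cI).
by rewrite -[X in c * v + X]opprK -E -mulrDr -mulrBr !(inj_eq cI) orbC.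
Qed.

End Isomorphism.

(** * Three or more layers *)

Section ManyLayers.

Local Open Scope ring_scope.

Variables (n t : nat) (j : t.-tuple nat).
Hypothesis Hj : GI_params n j.

Local Notation e := (GI n j).

(** A common neighbour outside layer s would be joined by spokes to both ends,
    whose second coordinates differ; inside the layer, v and w both step to
    it, and the only way to do so is to complete a triangle with three equal
    steps. *)
Lemma layer_common_neighbour s v w z :
  layer j (s, v) (s, w) -> e (s, v) z -> e (s, w) z ->
  z = (s, v + v - w) /\ (3 * tnth j s)%:R = 0 :> 'Z_n.
Proof.
case: z => r u vw; have [<-{r}|sr] := eqVneq s r; last first.
  rewrite !GI_other_layer // => /eqP<- /eqP wv.
  by move/layer_GI: vw; rewrite wv GI_irrefl.
(* With w = v + a or v - a and likewise for u, each of the eight sign patterns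
   gives a = 0 or 3 a = 0; the alternatives allow for the sign of E. *)
have := GI_params_j_neq0 Hj s; rewrite natrM !GI_same_layer.
move: vw; rewrite !layer_pair; set a := _%:R => vw /eqP a0 vu wu.
by case/orP: vw wu => /eqP->; case/orP: vu => /eqP->; case/orP;
   rewrite -subr_eq0 => /eqP E;
   first [ by case: a0; rewrite -E; ring
         | by case: a0; apply: oppr_inj; rewrite oppr0 -E; ring
         | by split; [congr (_, _); ring | rewrite -E; ring]
         | by split; [congr (_, _); ring
                     | apply: oppr_inj; rewrite oppr0 -E; ring]].
Qed.

(** A spoke over v with t - 2 common neighbours goes to an edge of layer s with
    at most one, so t = 3 and the whole spoke triangle over v goes into layer s.
    There every edge lies on a triangle, and so does every layer edge at a
    vertex over v, which gives 3 j_r = 0 for each r. *)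
Lemma skew_many_layers : (2 < t)%N -> graph_connected e ->
  (exists f : {perm GI_vertex n t}, skew_automorphism j f) -> t = 3 /\ n = 3.
Proof.
move=> t2 econn [f /skew_spoke_to_layer[g gE [[a v] [[b v'] []]]]].
rewrite /spoke /= => /andP[ab /eqP<-{v'}] gab.
case Ea: (g (a, v)) (gab) => [s u]; case Eb: (g (b, v)) => [s' u'].
rewrite /layer /= => /andP[/eqP ss' _]; subst s'.
have {}gab : layer j (s, u) (s, u') by rewrite -Ea -Eb.
have third r : r \notin [set a; b] ->
    g (r, v) = (s, u + u - u') /\ (3 * tnth j s)%:R = 0 :> 'Z_n.
  rewrite !inE negb_or => /andP[ra rb].
  by apply: layer_common_neighbour gab _ _; rewrite -?Ea -?Eb gE GI_other_layer // eq_sym.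
have cardC : #|~: [set a; b]| = (t - 2)%N by rewrite cardsCs setCK card_ord cards2 ab.
(* Distinct layers outside a and b give distinct common neighbours. *)
have t3 : t = 3.
  apply/eqP; rewrite eqn_leq t2 andbT -[3]/(2 + 1)%N -leq_subLR -cardC.
  apply/card_le1_eqP => r r'; rewrite !inE.
  rewrite -!in_set2 => /third[Er _] /third[Er' _].
  have /perm_inj : g (r, v) = g (r', v) by rewrite Er Er'.
  by move/(congr1 fst).
have spare (r r' : 'I_t) : exists r'', r'' \notin [set r; r'].
  have /card_gt0P[r''] : (0 < #|~: [set r; r']|)%N.
    rewrite cardsCs setCK card_ord cards2 subn_gt0.
    by case: (_ != _); rewrite // ltnW.
  by rewrite inE; exists r''.
have js3 : (3 * tnth j s)%:R = 0 :> 'Z_n by have [r /third[]] := spare a b.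
have onL r : exists z, g (r, v) = (s, z).
  have [|/third[-> _]] := boolP (r \in [set a; b]); last by eexists.
  by rewrite !inE => /orP[] /eqP->; [exists u | exists u'].
(* Layer edges in layer s close up after three steps, and spokes lie on the
   triangle of the three layers. *)
have triangle z y : e (s, z) y -> exists2 w, e (s, z) w & e y w.
  case: y => s' z'; have [<-|ss'] := eqVneq s s'.
    rewrite GI_same_layer layer_pair => zz'; exists (s, z + z - z').
      rewrite GI_same_layer layer_pair.
      by case/orP: zz' => /eqP->; apply/orP; [right | left]; apply/eqP; ring.
    move: js3; rewrite natrM GI_same_layer layer_pair.
    set c := _%:R => c3.
    case/orP: zz' => /eqP->; apply/orP; [left | right]; rewrite -subr_eq0.
      by rewrite -oppr_eq0 -c3; apply/eqP; ring.
    by rewrite -c3; apply/eqP; ring.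
  rewrite GI_other_layer // => /eqP<-.
  have [r] := spare s s'; rewrite !inE negb_or => /andP[rs rs'].
  by exists (r, z); rewrite GI_other_layer // eq_sym.
have j3 r : (3 * tnth j r)%:R = 0 :> 'Z_n.
  have vv' : layer j (r, v) (r, v + (tnth j r)%:R) by rewrite layer_pair eqxx.
  have := layer_GI vv'; rewrite -gE; have [z Ez] := onL r; rewrite Ez => /triangle[w].
  rewrite -Ez -(permKV g w) !gE => vw v'w.
  by have [] := layer_common_neighbour vv' vw v'w.
split=> //; apply/eqP; rewrite eqn_leq dvdn_leq ?(connected_annihilator Hj) //.
by case: Hj.
Qed.

End ManyLayers.

Lemma GI3_isomorphic (j : 3.-tuple nat) :
  GI_params 3 j -> isomorphic (GI 3 j) (GI 3 [tuple 1; 1; 1]).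
Proof.
case=> _ _ Hj; apply: (@GI_isomorphic _ _ _ _ 1%g 1%R); first exact: unitr1.
move=> s; rewrite mul1r perm1.
have -> : tnth [tuple 1; 1; 1] s = 1 by case: s => [[|[|[|//]]] ?].
have [/andP[]] := Hj s; case: (tnth j s) => [//|[|[|//]]] _ _ _; first by left.
by right; apply/val_inj.
Qed.

(** * Two layers: arc-transitivity *)

(** The translations and reflections leave four classes of arcs.  The skew map
    sends a spoke, in both directions, into the class A of the arcs of layer s:
    this fuses A with both spoke classes.  It also sends both ends of that
    spoke, hence a vertex of each layer, into layer s, so every layer arc
    leaving such an end goes to an arc that starts in layer s; those arcs are
    layer arcs of s or spokes, which are all fused already. *)
Lemma I_graph_skew_arc_transitive n (j : 2.-tuple nat) :
  (exists f : {perm GI_vertex n 2}, skew_automorphism j f) ->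
  arc_transitive (GI n j).
Proof.
case=> f /skew_spoke_to_layer[g gE [[a v] [[b v'] []]]].
rewrite /spoke /= => /andP[ab /eqP<-{v'}] gab.
case Ea: (g (a, v)) (gab) => [s u]; case Eb: (g (b, v)) => [s' u'].
rewrite /layer /= => /andP[/eqP ss' _]; subst s'.
have {}gab : layer j (s, u) (s, u') by rewrite -Ea -Eb.
have two (r : 'I_2) : r = a \/ r = b.
  move: ab; case: a {Ea} => [[|[|//]] ?]; case: b {Eb} => [[|[|//]] ?] //;
  by case: r => [[|[|//]] ?] => _; (left + right); apply: val_inj.
set A : GI_vertex n 2 * GI_vertex n 2 := ((s, u), (s, u')).
have rev_layer (w w' : 'Z_n) : layer j (s, w) (s, w') -> layer j (s, w') (s, w).
  by rewrite -!GI_same_layer GI_sym.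
have abA : same_arc_orbit (GI n j) A ((a, v), (b, v)).
  by apply: same_arc_orbit_sym; exists g; rewrite // Ea Eb.
have baA : same_arc_orbit (GI n j) A ((b, v), (a, v)).
  apply: same_arc_orbit_trans (same_arc_orbit_rev abA).
  exact: layer_same_arc_orbit gab (rev_layer _ _ gab).
have spokeA r r' w : r != r' -> same_arc_orbit (GI n j) A ((r, w), (r', w)).
  move=> rr'; apply: (@same_arc_orbit_trans _ _ ((r, v), (r', v))); last first.
    exact: spoke_same_arc_orbit.
  by move: rr'; case: (two r) => ->; case: (two r') => ->; rewrite ?eqxx.
apply: (@arc_transitive_from _ _ A) => [[r w] [r' w']].
case/orP; rewrite /spoke /layer /= => /andP[rr'].
  by move/eqP<-; apply: spokeA.
move/eqP: rr' => <-{r'}; rewrite -layer_pair => rww'.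
have rvv' : layer j (r, v) (r, v + (tnth j r)%:R)%R by rewrite layer_pair eqxx.
apply: same_arc_orbit_trans (layer_same_arc_orbit rvv' rww').
apply: same_arc_orbit_trans (same_arc_orbit_sym (same_arc_orbit_aut _ _ gE)).
have := layer_GI rvv'; rewrite -gE.
have [z ->] : exists z, g (r, v) = (s, z).
  by case: (two r) => ->; [exists u | exists u'].
case: (g _) => r' z'; have [<-|sr'] := eqVneq s r'.
  by rewrite GI_same_layer; apply: layer_same_arc_orbit gab.
by rewrite GI_other_layer // => /eqP<-; apply: spokeA.
Qed.

(** * Two layers: walks as formal words *)

Section FormalWalks.

Local Open Scope ring_scope.

(** The layer of the head of an arc, and how the arc arrives there: along a
    spoke (None), or by a layer step in the positive or negative direction. *)
Definition arc_type := (bool * option bool)%type.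

(** The net numbers of steps made in layer 0 and in layer 1. *)
Definition displacement := (int * int)%type.

Definition sign (d : bool) : int := if d then 1 else -1.

Definition shift (s d : bool) (p : displacement) : displacement :=
  if s then (p.1, p.2 + sign d) else (p.1 + sign d, p.2).

(** A non-backtracking walk in a cubic graph has two continuations at each
    vertex, here written down without reference to n and to the steps. *)
Fixpoint formal_walks (m : nat) (a : arc_type) (p : displacement) :
    seq (arc_type * displacement) :=
  if m is m'.+1 then
    match a with
    | (s, None) => formal_walks m' (s, Some true) (shift s true p) ++
                   formal_walks m' (s, Some false) (shift s false p)
    | (s, Some d) => formal_walks m' (s, Some d) (shift s d p) ++
                     formal_walks m' (~~ s, None) p
    end
  else [:: (a, p)].

Definition closed_walks (m : nat) (a : arc_type) : seq displacement :=
  [seq x.2 | x <- formal_walks m a (0, 0) & x.1 == a].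

Definition relation (n j k : nat) (p : displacement) : bool :=
  (n %| absz (p.1 * j%:Z + p.2 * k%:Z)%R)%N.

Definition balanced (n j k m : nat) : Prop :=
  forall a b, count (relation n j k) (closed_walks m a) =
              count (relation n j k) (closed_walks m b).

Lemma Zp_int_eq0 n (z : int) : (1 < n)%N -> (z%:~R == 0 :> 'Z_n) = (n %| absz z)%N.
Proof.
move=> n1; rewrite -(Zp_nat_eq0 _ n1); case: z => m; first by [].
by rewrite NegzE rmorphN oppr_eq0.
Qed.

Variables (n : nat) (i : 2.-tuple nat).
Hypothesis Hi : GI_params n i.

Definition side (s : bool) : 'I_2 := if s then ord_max else ord0.

Lemma side_inj : injective side. Proof. by do 2!case. Qed.

Lemma sideP (r : 'I_2) : exists s, r = side s.
Proof.
by case: r => [[|[|//]] ?]; [exists false | exists true]; apply: val_inj.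
Qed.

Let step (s : bool) : 'Z_n := (tnth i (side s))%:R.

Definition position (p : displacement) : 'Z_n :=
  p.1%:~R * step false + p.2%:~R * step true.

Lemma position_shift s d p :
  position (shift s d p) = position p + (sign d)%:~R * step s.
Proof.
rewrite /position; case: s; rewrite /= rmorphD mulrDl ?addrA //.
by rewrite [RHS]addrAC.
Qed.

Definition arc_head (a : arc_type) (p : displacement) : GI_vertex n 2 :=
  (side a.1, position p).

Definition arc_tail (a : arc_type) (p : displacement) : GI_vertex n 2 :=
  if a.2 is Some d then (side a.1, position p - (sign d)%:~R * step a.1)
  else (side (~~ a.1), position p).

Lemma GI_neighbour s (v : 'Z_n) w : GI n i (side s, v) w =
  [|| w == (side (~~ s), v), w == (side s, v + step s) |
      w == (side s, v - step s)].
Proof.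
case: w => r u; have [s' ->] := sideP r.
rewrite /GI /spoke /layer /= !xpair_eqE ![side s' == _]eq_sym.
by rewrite !(inj_eq side_inj) [u == v]eq_sym; case: s s' => [] [] /=.
Qed.

(** This is where j_s must differ from n / 2: the two layer neighbours of a
    vertex are distinct, so that a layer arc determines its direction. *)
Lemma double_step_nonzero s : step s + step s != 0.
Proof.
have n1 := GI_params_n_gt1 Hi; case: Hi => _ _ /(_ (side s)).
rewrite /step -natrD Zp_nat_eq0 // addnn; set h := tnth i _.
case=> /andP[h0 hn] hh; apply/negP => /dvdnP[[|[|q]]].
- by move/eqP; rewrite mul0n double_eq0 -leqn0 leqNgt h0.
- by rewrite mul1n.
move=> E; have: (h.*2 < n.*2)%N by rewrite ltn_double.
by rewrite E -mul2n ltnNge leq_mul2r !ltnS orbT.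
Qed.

Lemma arc_head_tail a p : GI n i (arc_tail a p) (arc_head a p).
Proof.
case: a => s [d|]; rewrite GI_sym /arc_head /arc_tail GI_neighbour /= ?eqxx //.
by case: d; rewrite ?mul1r ?mulN1r ?opprK ?eqxx ?orbT.
Qed.

(** The tail of a layer arc lies in the layer of its head and the tail of a
    spoke does not; the sign of a layer arc can be read off since its step is
    not its own opposite. *)
Lemma arc_codes_eq a b p q :
  (arc_tail a p == arc_tail b q) && (arc_head a p == arc_head b q) =
  (a == b) && (position p == position q).
Proof.
case: a b => s c [s' c']; rewrite /arc_head /arc_tail /= !xpair_eqE.
rewrite (inj_eq side_inj) [LHS]andbCA; have [<-{s'}|//] := eqVneq s s'.
rewrite !andTb [LHS]andbC [RHS]andbC; have [->|//] := eqVneq (position p).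
have NsE : (side (~~ s) == side s) = false by case: s.
have stepN : (step s == - step s) = false.
  by rewrite -addr_eq0 (negbTE (double_step_nonzero s)).
rewrite !andTb; case: c c' => [d|] [d'|] //=.
- rewrite !xpair_eqE eqxx /= (inj_eq (@subrI _ _)).
  by case: d d' => [] []; rewrite ?mul1r ?mulN1r ?eqxx ?stepN // eq_sym stepN.
- by rewrite xpair_eqE eq_sym NsE.
- by rewrite xpair_eqE NsE.
by rewrite eqxx.
Qed.

Lemma arc_tail_shift s d p : arc_tail (s, Some d) (shift s d p) = (side s, position p).
Proof. by rewrite /arc_tail /= position_shift addrK. Qed.

Lemma arc_head_shift s d p :
  arc_head (s, Some d) (shift s d p) = (side s, position p + (sign d)%:~R * step s).
Proof. by rewrite /arc_head position_shift. Qed.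

(** The two formal continuations of an arc are exactly the two neighbours of
    its head other than its tail, so the recursions for walks and for words
    agree. *)
Lemma formal_walksP m a p b q :
  nb_walks (GI n i) m (arc_tail a p) (arc_head a p) (arc_tail b q) (arc_head b q) =
  count (fun x => (x.1 == b) && (position x.2 == position q)) (formal_walks m a p).
Proof.
have sum2 (F : GI_vertex n 2 -> nat) (P : pred _) w1 w2 : w1 != w2 ->
    P =1 (fun w => (w == w1) || (w == w2)) -> (\sum_(w | P w) F w = F w1 + F w2)%N.
  move=> w12 PE; rewrite (bigD1 w1) ?PE ?eqxx //=; congr (_ + _)%N.
  apply: big_pred1 => w; rewrite PE /=.
  by case: (eqVneq w w1) => [->|]; rewrite ?(negbTE w12) ?andbT ?orbF.
elim: m => [|m IH] in a p *.
  by rewrite /= addn0 arc_codes_eq.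
have stepE s : (position p + step s == position p - step s) = false.
  by rewrite (inj_eq (addrI _)) -addr_eq0 (negbTE (double_step_nonzero s)).
have sideN s : (side (~~ s) == side s) = false by case: s.
case: a => s [d|] /=; rewrite count_cat -!IH.
- rewrite (sum2 _ _ (arc_head (s, Some d) (shift s d p)) (arc_head (~~ s, None) p)).
  + by rewrite arc_tail_shift /arc_tail /= negbK.
  + by rewrite /arc_head xpair_eqE eq_sym sideN.
  move=> w; rewrite arc_head_shift /arc_head GI_neighbour /arc_tail /=.
  have [->|wN] /= := eqVneq w (side (~~ s), _).
    by rewrite xpair_eqE sideN orbT.
  case: d => /=; rewrite ?mul1r ?mulN1r ?opprK orbF.
    have [->|_] := eqVneq w (_, _ + _); first by rewrite xpair_eqE eqxx stepE.
    by case: eqP.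
  have [->|_] := eqVneq w (_, _ - _); last by case: eqP.
  by rewrite xpair_eqE eqxx eq_sym stepE orbT.
rewrite (sum2 _ _ (arc_head (s, Some true) (shift s true p))
  (arc_head (s, Some false) (shift s false p))).
- by rewrite !arc_tail_shift.
- by rewrite !arc_head_shift /= mul1r mulN1r xpair_eqE eqxx stepE.
move=> w; rewrite !arc_head_shift /arc_head GI_neighbour /arc_tail /= mul1r mulN1r.
have [->|_] /= := eqVneq w (side (~~ s), _); last by rewrite andbT.
by rewrite !xpair_eqE sideN.
Qed.

Lemma closed_walksP m a :
  nb_walks (GI n i) m (arc_tail a (0, 0)) (arc_head a (0, 0))
                      (arc_tail a (0, 0)) (arc_head a (0, 0)) =
  count (relation n (tnth i ord0) (tnth i ord_max)) (closed_walks m a).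
Proof.
rewrite formal_walksP /closed_walks count_map count_filter.
apply: eq_count => x /=; rewrite andbC; congr (_ && _).
have -> : position (0, 0) = 0 by rewrite /position !mul0r addr0.
by rewrite /relation -Zp_int_eq0 ?(GI_params_n_gt1 Hi) // intrD !intrM.
Qed.

Lemma arc_transitive_balanced m : arc_transitive (GI n i) ->
  balanced n (tnth i ord0) (tnth i ord_max) m.
Proof.
move=> iT a b; rewrite -!closed_walksP.
exact: nb_walks_arc_transitive (arc_head_tail _ _) (arc_head_tail _ _).
Qed.

End FormalWalks.

(** * Relations among short walks *)

Section ShortRelations.

Local Open Scope ring_scope.

Definition det (p q : displacement) : int := p.1 * q.2 - p.2 * q.1.

(** The displacements of closed walks of length 8, up to sign and apart from
    (0, 0), (2, 0) and (0, 2).  Such a walk contains an even number of spokes: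
    none (8 steps in one layer), two (1 to 5 steps in one layer, the others of the
    6 in the other layer) or four (single steps, two in each layer). *)
Definition short_relations : seq displacement :=
  [:: (8, 0); (0, 8); (1, 5); (1, -5); (2, 4); (2, -4); (3, 3); (3, -3);
      (4, 2); (4, -2); (5, 1); (5, -1); (2, 2); (2, -2)].

Definition normalise (p : displacement) : displacement :=
  if (p.1 < 0) || ((p.1 == 0) && (p.2 < 0)) then (- p.1, - p.2) else p.

(** Layer arcs of layer 0, spokes towards layer 0, layer arcs of layer 1. *)
Definition arc_classes : seq arc_type :=
  [:: (false, Some true); (false, None); (true, Some true)].

(** The displacements (2, 0) and (0, 2) are dropped because a step is never its
    own opposite. *)
Definition reduced_walks (a : arc_type) : seq displacement :=
  [seq p <- map normalise (closed_walks 8 a) | p \notin [:: (2, 0); (0, 2)]].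

Lemma reduced_walks_short a : a \in arc_classes ->
  {subset reduced_walks a <= (0, 0) :: short_relations}.
Proof.
move=> aC; apply/allP; move: a aC; apply/allP; by vm_compute.
Qed.

Lemma relation_normalise n j k p : relation n j k (normalise p) = relation n j k p.
Proof.
rewrite /normalise; case: ifP => // _; rewrite /relation /= -abszN.
by congr (n %| absz _)%N; ring.
Qed.

Lemma count_reduced_walks n j k a :
  ~~ relation n j k (2, 0) -> ~~ relation n j k (0, 2) ->
  count (relation n j k) (closed_walks 8 a) = count (relation n j k) (reduced_walks a).
Proof.
move=> r20 r02; rewrite count_filter count_map.
apply: eq_count => p /=; rewrite relation_normalise !inE.
rewrite -relation_normalise; move: (normalise p) => q.
by case: eqP => [->|_]; case: eqP => [->|_]; rewrite ?(negbTE r20) ?(negbTE r02) ?andbT.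
Qed.

(** The only form that the relations among the short displacements can take if
    all lie on the line of p: zero, p, and possibly the rest of that line. *)
Definition on_line (p : displacement) (b : bool) (q : displacement) : bool :=
  (det p q == 0) && [|| q == (0, 0), q == p | b].

Lemma on_line_unbalanced :
  all (fun p => all (fun b => ~~ all (fun a =>
        count (on_line p b) (reduced_walks a) ==
        count (on_line p b) (reduced_walks (false, None))) arc_classes)
      [:: true; false]) short_relations.
Proof. by vm_compute. Qed.

(** If the relations among the short displacements span at most a line, then
    they are known up to one boolean, since a line contains at most two short
    displacements, namely (2, 2) and (3, 3) or (2, -2) and (3, -3).  Each
    resulting set of relations gives different numbers of closed walks through
    spokes and through layer arcs. *)
Lemma balanced_two_relations n j k :
  ~~ relation n j k (2, 0) -> ~~ relation n j k (0, 2) -> balanced n j k 8 ->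
  exists p q, [/\ p \in short_relations, q \in short_relations,
                  relation n j k p, relation n j k q & det p q != 0].
Proof.
move=> r20 r02 bal; have r00 : relation n j k (0, 0) by rewrite /relation !mul0r.
have {bal} bal a b :
    count (relation n j k) (reduced_walks a) = count (relation n j k) (reduced_walks b).
  by rewrite -!count_reduced_walks.
case: (boolP (has (fun p => relation n j k p &&
                 has (fun q => relation n j k q && (det p q != 0)) short_relations)
               short_relations)).
  case/hasP=> p pV /andP[rp /hasP[q qV /andP[rq pq]]].
  by exists p, q.
move/hasPn=> line; exfalso; move: r00 bal line {r20 r02}; move: (relation n j k) => r.
move=> r00 bal line.
have line_count p a : p \in short_relations -> r p -> a \in arc_classes ->
    count r (reduced_walks a) = count r [seq q <- reduced_walks a | det p q == 0].
  move=> pV rp aC; rewrite count_filter.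
  apply: eq_in_count => q /(reduced_walks_short aC) qV /=.
  case rq: (r q) => //=; move: qV; rewrite inE => /orP[/eqP->|qV].
    by rewrite /det !mulr0.
  apply/esym; apply: contraNT (line p pV) => pq; rewrite rp.
  by apply/hasP; exists q; rewrite ?rq.
case: (boolP (has r short_relations)) => [/hasP[p pV rp]|/hasPn rN].
  pose others := [seq q <- short_relations | (det p q == 0) && (q != p)].
  have [b othersE] : exists b, forall q, q \in others -> r q = b.
    have : (size others <= 1)%N by move: p pV {rp} @others; apply/allP; vm_compute.
    case: others => [|q [|//]] _; first by exists true.
    by exists (r q) => q'; rewrite inE => /eqP->.
  have line_countE a : a \in arc_classes ->
      count r (reduced_walks a) = count (on_line p b) (reduced_walks a).
    move=> aC; rewrite (line_count p) // count_filter.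
    apply: eq_in_count => q /(reduced_walks_short aC) qV /=; rewrite /on_line.
    have [pq|_] := eqVneq (det p q) 0; rewrite ?andbF // andbT.
    move: qV; rewrite inE; case: eqP => [->|_] //= qV.
    case: eqP => [->|/eqP qp] //=.
    by apply: othersE; rewrite mem_filter pq eqxx qp.
  have /allP/(_ p pV)/allP/(_ b) := on_line_unbalanced.
  case/(_ _)/negP; first by case: (b).
  by apply/allP => a aC; rewrite -!line_countE // (bal a (false, None)).
(* Without relations only the displacement (0, 0) counts: 4 walks through a
   spoke, 2 through a layer arc. *)
have no_relation a : a \in arc_classes ->
    count r (reduced_walks a) = count (pred1 (0, 0)) (reduced_walks a).
  move=> aC; apply: eq_in_count => q /(reduced_walks_short aC).
  rewrite inE => /predU1P[->|/rN rq]; first by rewrite r00.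
  rewrite (negbTE rq) /=.
  by apply/esym; apply: contraNF rq => /eqP->.
have := etrans (esym (no_relation (false, Some true) isT))
  (etrans (bal _ _) (no_relation (false, None) isT)).
by vm_compute.
Qed.

End ShortRelations.

(** * The finite list of exceptional parameters *)

Definition determinants : seq nat :=
  [seq `|det p q|%N | p <- short_relations, q <- short_relations].

(** The bound 64 is the largest determinant, that of (8, 0) and (0, 8). *)
Definition orders : seq nat :=
  [seq n <- iota 3 62 | has (fun d => (d != 0) && (n %| d)) determinants].

Definition admissible (n : nat) (jk : nat * nat) : bool :=
  let: (j, k) := jk in
  [&& j.*2 != n, k.*2 != n & gcdn n (gcdn j k) == 1].

Definition two_relations (n : nat) (jk : nat * nat) : bool :=
  let R := [seq p <- short_relations | relation n jk.1 jk.2 p] in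
  has (fun p => has (fun q => det p q != 0%R) R) R.

Definition balancedb (n : nat) (walks : seq (seq displacement)) (jk : nat * nat) :
    bool :=
  constant [seq count (relation n jk.1 jk.2) w | w <- walks].

Definition congruent_up_to_sign (n x y : nat) : bool :=
  (x == y %[mod n]) || (n %| x + y).

Definition multiplier (n : nat) (jk jk' : nat * nat) (u : nat) : bool :=
  [&& coprime n u, congruent_up_to_sign n (u * jk.1) jk'.1 &
      congruent_up_to_sign n (u * jk.2) jk'.2].

Definition exceptional (n : nat) (jk : nat * nat) : bool :=
  has (fun nk => (n == nk.1) &&
    has (fun u => multiplier n jk (1, nk.2) u || multiplier n jk (nk.2, 1) u)
        (iota 1 n.-1)) exceptional_GP.

(** The successive filters keep the expensive counts for the few pairs that
    pass the cheap tests.  Length 8 alone would leave pairs equivalent to (1, 5)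
    for n = 13 and n = 26; the walks of length 10 exclude them. *)
Definition balanced_pairs (n : nat) : seq (nat * nat) :=
  let pairs := [seq (j, k) | j <- iota 1 n.-1, k <- iota 1 n.-1] in
  [seq jk <- [seq jk <- [seq jk <- [seq jk <- pairs | admissible n jk]
                                 | two_relations n jk]
                     | balancedb n (map (closed_walks 8) arc_classes) jk]
         | balancedb n (map (closed_walks 10) arc_classes) jk].

Lemma balanced_pairs_exceptional :
  all (fun n => all (exceptional n) (balanced_pairs n)) orders.
Proof. by vm_compute. Qed.

Section Classification.

Variables (n : nat) (i : 2.-tuple nat).
Hypothesis Hi : GI_params n i.
Hypothesis i_conn : graph_connected (GI n i).

Local Notation j := (tnth i ord0).
Local Notation k := (tnth i ord_max).

Lemma ord2P (P : 'I_2 -> Prop) : P ord0 -> P ord_max -> forall s, P s.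
Proof.
move=> P0 P1 [[|[|//]] s2]; first by rewrite (_ : Ordinal s2 = ord0) //; apply: val_inj.
by rewrite (_ : Ordinal s2 = ord_max) //; apply: val_inj.
Qed.

(** If d divides n, j and k, then n / d annihilates both steps. *)
Lemma connected_gcdn : gcdn n (gcdn j k) = 1.
Proof.
have n0 : 0 < n by apply: ltnW (GI_params_n_gt1 Hi).
set d := gcdn n _; have dn : d %| n by apply: dvdn_gcdl.
have d0 : 0 < d by rewrite gcdn_gt0 n0.
have dE m : d %| m -> n %| n %/ d * m.
  by case/dvdnP=> q ->; rewrite mulnCA divnK // dvdn_mull.
have /dvdn_leq : n %| n %/ d.
  apply: (connected_annihilator Hi i_conn) => s.
  apply/eqP; rewrite Zp_nat_eq0 ?(GI_params_n_gt1 Hi) //; apply: dE.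
  have /(dvdn_trans (dvdn_gcdr n _)) : gcdn j k %| tnth i s.
    by move: s; apply: ord2P; [apply: dvdn_gcdl | apply: dvdn_gcdr].
  by [].
rewrite divn_gt0 // dvdn_leq // => /(_ isT); rewrite leq_divRL //.
by rewrite -[X in _ <= X]muln1 leq_pmul2l // => d1; apply/eqP; rewrite eqn_leq d1.
Qed.

(** By Cramer's rule the determinant annihilates both steps. *)
Lemma relations_determinant p q :
  relation n j k p -> relation n j k q -> n %| `|det p q|%N.
Proof.
move=> rp rq; apply: (connected_annihilator Hi i_conn) => s.
apply/eqP; rewrite Zp_nat_eq0 ?(GI_params_n_gt1 Hi) //.
suff : (n%:Z %| (det p q * (tnth i s)%:Z)%R)%Z by rewrite dvdzE abszM.
have {}rp : (n%:Z %| (p.1 * j%:Z + p.2 * k%:Z)%R)%Z by rewrite dvdzE.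
have {}rq : (n%:Z %| (q.1 * j%:Z + q.2 * k%:Z)%R)%Z by rewrite dvdzE.
move: s; apply: ord2P.
  rewrite (_ : (_ * _)%R = q.2 * (p.1 * j%:Z + p.2 * k%:Z) -
                           p.2 * (q.1 * j%:Z + q.2 * k%:Z))%R.
    by rewrite rpredB ?dvdz_mull.
  by rewrite /det; ring.
rewrite (_ : (_ * _)%R = p.1 * (q.1 * j%:Z + q.2 * k%:Z) -
                         q.1 * (p.1 * j%:Z + p.2 * k%:Z))%R.
  by rewrite rpredB ?dvdz_mull.
by rewrite /det; ring.
Qed.

Lemma double_not_relation s : ~~ (n %| (tnth i s).*2).
Proof.
have := double_step_nonzero Hi (s == ord_max).
have -> : side (s == ord_max) = s by move: s; apply: ord2P.
by rewrite -natrD Zp_nat_eq0 ?(GI_params_n_gt1 Hi) // addnn.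
Qed.

Lemma balanced_exceptional :
  balanced n j k 8 -> balanced n j k 10 -> exceptional n (j, k).
Proof.
move=> bal8 bal10.
have n3 : 3 <= n by case: Hi.
have [||p [q [pV qV rp rq pq0]]] := balanced_two_relations _ _ bal8.
- by rewrite /relation /= mul0n addn0 -[1 + 1]/2 mul2n double_not_relation.
- by rewrite /relation /= mul0n -[1 + 1]/2 mul2n double_not_relation.
have pqn := relations_determinant rp rq.
have det0 : `|det p q|%N != 0 by rewrite absz_eq0.
have detV : `|det p q|%N \in determinants by apply: allpairs_f.
have nO : n \in orders.
  rewrite mem_filter mem_iota n3; apply/andP; split.
    by apply/hasP; exists `|det p q|%N; rewrite ?det0.
  rewrite ltnS; apply: leq_trans (dvdn_leq _ pqn) _; first by rewrite lt0n.
  have /allP det64 : all (fun d => d <= 64) determinants by vm_compute.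
  exact: det64.
have range s : tnth i s \in iota 1 n.-1.
  have [_ _ /(_ s)[/andP[s0 sn] _]] := Hi.
  by rewrite mem_iota s0 add1n prednK // (leq_trans _ n3).
have constB m w : balanced n j k m -> balancedb n (map (closed_walks m) w) (j, k).
  move=> bal; rewrite /balancedb -map_comp; case: w => //= a w.
  by apply/allP => _ /mapP[b _ ->] /=; rewrite (bal b a).
have /allP/(_ (j, k)) := allP balanced_pairs_exceptional n nO; apply.
rewrite !mem_filter; apply/and5P; split.
- exact: constB.
- exact: constB.
- apply/hasP; exists p; first by rewrite mem_filter rp.
  by apply/hasP; exists q; first by rewrite mem_filter rq.
- have neq s : (tnth i s).*2 != n by apply/eqP; case: Hi => _ _ /(_ s)[_].
  by apply/and3P; split; rewrite ?neq // connected_gcdn.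
exact: allpairs_f.
Qed.

Lemma multiplier_isomorphic (i' : 2.-tuple nat) (p : {perm 'I_2}) u :
  multiplier n (j, k) (tnth i' (p ord0), tnth i' (p ord_max)) u ->
  isomorphic (GI n i) (GI n i').
Proof.
have n1 := GI_params_n_gt1 Hi.
case/and3P=> /= un ju ku; apply: (@GI_isomorphic n _ i i' p (u%:R)%R).
  by rewrite unitZpE.
have congE x y : congruent_up_to_sign n x y ->
    (x%:R = y%:R :> 'Z_n \/ x%:R = - y%:R :> 'Z_n)%R.
  case/orP=> [/eqP E|xy]; [left | right].
    by apply/val_inj; rewrite /= !val_Zp_nat.
  by apply/eqP; rewrite -addr_eq0 -natrD Zp_nat_eq0.
by apply: ord2P; rewrite -natrM; apply: congE.
Qed.

Lemma exceptional_isomorphic : exceptional n (j, k) ->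
  exists2 nk, nk \in exceptional_GP & isomorphic (GI n i) (GP nk.1 nk.2).
Proof.
case/hasP=> [[n' k'] nkE /= /andP[/eqP n'E]] /hasP[u _ /orP uE].
exists (n', k') => //=; rewrite -n'E; case: uE => uE.
  by apply: (@multiplier_isomorphic _ 1%g u); rewrite !perm1.
apply: (@multiplier_isomorphic _ (tperm ord0 ord_max) u).
by rewrite tpermL tpermR.
Qed.

End Classification.

(** * Skew involutions of the seven generalized Petersen graphs *)

Section PeriodicInvolutions.

Local Open Scope ring_scope.

(** A map of the vertices that commutes with the translation by m is given, for
    each layer and each residue modulo m, by the layer of the image and the
    shift of the second coordinate; m is the length of the rows. *)
Definition shift_table := seq (seq (bool * int)).

Definition table_map (n : nat) (T : shift_table) (x : GI_vertex n 2) : GI_vertex n 2 :=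
  let row := nth [::] T x.1 in
  let c := nth (false, 0) row (x.2 %% size row)%N in
  (side c.1, x.2 + c.2%:~R).

Definition vertices (n : nat) : seq (GI_vertex n 2) :=
  [seq (side s, inZp v) | s <- [:: false; true], v <- iota 0 n].

Lemma mem_vertices n x : (1 < n)%N -> x \in vertices n.
Proof.
case: x => s v n1; have [b ->] := sideP s; rewrite -(valZpK v).
by apply: allpairs_f; [case: b | rewrite mem_iota /= -[X in (_ < X)%N](Zp_cast n1)].
Qed.

Definition skew_involution_check (n k : nat) (T : shift_table) : bool :=
  [&& all (fun x => table_map T (table_map T x) == x) (vertices n),
      all (fun x => all (fun y => GP n k x y ==> GP n k (table_map T x) (table_map T y))
        (vertices n)) (vertices n) &
      has (fun x => has (fun y => spoke x y &&
          layer [tuple 1%N; k] (table_map T x) (table_map T y))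
        (vertices n)) (vertices n)].

(** For an involution, sending edges to edges is enough to be an automorphism. *)
Lemma skew_involution_arc_transitive n k T : (1 < n)%N ->
  skew_involution_check n k T -> arc_transitive (GP n k).
Proof.
move=> n1 /and3P[/allP TK /allP T_edge /hasP[x _ /hasP[y _ /andP[xy Txy]]]].
have {}TK : involutive (@table_map n T) by move=> z; apply/eqP/TK/mem_vertices.
have {}T_edge u v : GP n k u v -> GP n k (table_map T u) (table_map T v).
  by apply/implyP; apply: (allP (T_edge u _)); apply: mem_vertices.
apply: I_graph_skew_arc_transitive; exists (perm (inv_inj TK)); split.
  move=> u v; rewrite !permE; apply/idP/idP => [/T_edge|]; last exact: T_edge.
  by rewrite !TK.
case=> /(_ x y xy) + _; rewrite !permE.
by move: Txy; rewrite /spoke /layer => /andP[/eqP->]; rewrite eqxx.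
Qed.

(** Skew involutions of period 4 exist for G(4,1), G(8,3), G(12,5), G(24,5), and
    of period 5 for G(5,2), G(10,2), G(10,3); within each family they can be
    chosen with the same first shifts, so that only c and d depend on the
    graph. *)
Definition mod4_table (c : int) : shift_table :=
  [:: [:: (false, 1); (false, -1); (true, -2); (true, 2)];
      [:: (false, 2); (false, -2); (true, c); (true, - c)]].

Definition mod5_table (c d : int) : shift_table :=
  [:: [:: (false, 0); (true, -1); (true, d); (true, 1); (false, 0)];
      [:: (false, 1); (true, c); (false, d); (true, - c); (false, -1)]].

Definition exceptional_tables : seq shift_table :=
  [:: mod4_table 1; mod5_table 2 0; mod4_table 1; mod5_table 7 0;
      mod5_table 2 5; mod4_table 5; mod4_table 17].

Lemma exceptional_tables_check :
  all (fun x => (1 < x.1.1)%N && skew_involution_check x.1.1 x.1.2 x.2)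
      (zip exceptional_GP exceptional_tables).
Proof. by vm_compute. Qed.

Lemma exceptional_GP_arc_transitive nk :
  nk \in exceptional_GP -> arc_transitive (GP nk.1 nk.2).
Proof.
rewrite -[exceptional_GP]/(unzip1 (zip exceptional_GP exceptional_tables)).
case/mapP=> -[nk' T] /(allP exceptional_tables_check)/andP[/= n1 check] ->.
exact: skew_involution_arc_transitive n1 check.
Qed.

End PeriodicInvolutions.

(** * The rook graph *)

Section Rook.

Local Notation e := (GI 3 [tuple 1; 1; 1]).

Lemma two_transitive (T : finType) (x x' y y' : T) : x != x' -> y != y' ->
  exists p : {perm T}, p x = y /\ p x' = y'.
Proof.
move=> xx' yy'; exists (tperm x y * tperm (tperm x y x') y')%g.
rewrite !permM tpermL tpermL; split=> //; apply: tpermD; last by rewrite eq_sym.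
by rewrite -[X in _ != X](tpermL x y) (inj_eq perm_inj) eq_sym.
Qed.

Definition coordinates_swap (x : 'I_3 * 'I_3) : 'I_3 * 'I_3 := (x.2, x.1).

(** In Z_3 any two distinct elements differ by 1 or - 1, so a layer is a
    triangle just as a set of spokes over one point is. *)
Lemma GI3E (x y : 'I_3 * 'I_3) :
  e x y = (x.1 != y.1) && (x.2 == y.2) || (x.1 == y.1) && (x.2 != y.2).
Proof.
case: x y => [s v] [s' w]; rewrite /GI /spoke /layer /=; congr (_ || _ && _).
have -> : tnth [tuple 1; 1; 1] s = 1 by case: s => [[|[|[|//]]] ?].
by case: v => [[|[|[|//]]] ?]; case: w => [[|[|[|//]]] ?].
Qed.

Lemma coordinates_swapK : involutive coordinates_swap.
Proof. by case. Qed.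

Lemma prod_perm_inj (p q : {perm 'I_3}) :
  injective (fun x : 'I_3 * 'I_3 => (p x.1, q x.2)).
Proof. by move=> [s v] [s' w] /pair_equal_spec[/= /perm_inj-> /perm_inj->]. Qed.

(** Permutations of the layers act transitively on the ordered pairs of layers,
    which fuses all spokes; exchanging the coordinates turns the layer arcs into
    spokes. *)
Lemma GI3_arc_transitive : arc_transitive e.
Proof.
have prodE (p q : {perm 'I_3}) : automorphism e (perm (@prod_perm_inj p q)).
  by move=> x y; rewrite !permE !GI3E !(inj_eq perm_inj).
have swapE : automorphism e (perm (inv_inj coordinates_swapK)).
  move=> x y; rewrite !permE !GI3E /= orbC; congr (_ || _); exact: andbC.
have spokes (s s' r r' v w : 'I_3) : s != s' -> r != r' ->
    same_arc_orbit e ((s, v), (s', v)) ((r, w), (r', w)).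
  move=> ss' rr'; have [p [ps ps']] := two_transitive ss' rr'.
  exists (perm (@prod_perm_inj p (tperm v w))); first exact: prodE.
  by rewrite !(permE (@prod_perm_inj p _)) /= ps ps' tpermL.
apply: (@arc_transitive_from _ _ ((ord0, ord0), (ord_max, ord0))) => -[s v] [s' w].
rewrite GI3E /= => /orP[/andP[ss' /eqP<-]|/andP[/eqP<- vw]]; first exact: spokes.
apply: (@same_arc_orbit_trans _ _ ((v, s), (w, s))); first exact: spokes.
by exists (perm (inv_inj coordinates_swapK)); rewrite ?permE.
Qed.

End Rook.

(** * Classification *)

Theorem theorem5 :
  (forall (n t : nat) (j : t.-tuple nat),
      GI_params n j -> 2 <= t ->
      graph_connected (GI n j) ->
      (exists f : {perm GI_vertex n t}, skew_automorphism j f) ->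
      (t = 2 /\ exists2 nk, nk \in exceptional_GP &
                  isomorphic (GI n j) (GP nk.1 nk.2)) \/
      (t = 3 /\ isomorphic (GI n j) (GI 3 [tuple 1; 1; 1]))) /\
  (forall nk, nk \in exceptional_GP ->
      [/\ arc_transitive (GP nk.1 nk.2),
          vertex_transitive (GP nk.1 nk.2) &
          edge_transitive (GP nk.1 nk.2)]) /\
  [/\ arc_transitive (GI 3 [tuple 1; 1; 1]),
      vertex_transitive (GI 3 [tuple 1; 1; 1]) &
      edge_transitive (GI 3 [tuple 1; 1; 1])].
Proof.
split; last first.
  split=> [nk nkE|]; apply: GI_arc_vertex_edge_transitive.
    exact: exceptional_GP_arc_transitive.
  exact: GI3_arc_transitive.
move=> n t j Hj t2 jconn jskew; case: (ltngtP t 2) t2 => // [t3|tE] _.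
  have [tE nE] := skew_many_layers Hj t3 jconn jskew.
  by right; split=> //; subst t n; apply: GI3_isomorphic.
left; split=> //; subst t; apply: (exceptional_isomorphic Hj).
have jT := I_graph_skew_arc_transitive jskew.
by apply: (balanced_exceptional Hj jconn); apply: arc_transitive_balanced.
Qed.
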